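(* Let $\mathfrak{A}$ be a $C^*$-algebra, let $\mathscr{H},\mathscr{K}$ be Hilbert $\mathfrak{A}$-modules, and let $A\in\mathcal{L}(\mathscr{H},\mathscr{K})$ be semi-regular. Then for any $C\in\mathcal{L}(\mathscr{H},\mathscr{K})$, the system $$AX=C,\quad X\in\mathcal{L}(\mathscr{H})_{sa}$$ has a solution if and only if $$\mathcal{R}(C)\subseteq\mathcal{R}(A)\ \text{ and }\ CA^*\ \text{is Hermitian}.$$ In such case, the general solution of this system has the form $$X=D+(I-U_A^*U_A)D^*+(I-U_A^*U_A)Y(I-U_A^*U_A),$$ where $D\in\mathcal{L}(\mathscr{H})$ is the reduced solution of $AX=C$, $U_A\in\mathcal{L}(\mathscr{H},\mathscr{K})$ is the partial isometry associated with $A$, and $Y\in\mathcal{L}(\mathscr{H})_{sa}$ is arbitrary.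
   Context: For Hilbert $\mathfrak{A}$-modules $\mathscr{H},\mathscr{K}$, $\mathcal{L}(\mathscr{H},\mathscr{K})$ denotes the set of adjointable operators from $\mathscr{H}$ to $\mathscr{K}$, $\mathcal{L}(\mathscr{H})=\mathcal{L}(\mathscr{H},\mathscr{H})$, $\mathcal{L}(\mathscr{H})_{sa}$ is the set of Hermitian (self-adjoint) elements of $\mathcal{L}(\mathscr{H})$, and $\mathcal{R}(\cdot)$ denotes the range. A closed submodule $M$ of $\mathscr{H}$ is orthogonally complemented if $\mathscr{H}=M\oplus M^\perp$, where $M^\perp=\{x\in\mathscr{H}:\langle x,y\rangle=0 \text{ for any } y\in M\}$; then $P_M$ denotes the projection from $\mathscr{H}$ onto $M$. An operator $A\in\mathcal{L}(\mathscr{H},\mathscr{K})$ is semi-regular if $\overline{\mathcal{R}(A)}$ and $\overline{\mathcal{R}(A^* )}$ are orthogonally complemented in $\mathscr{K}$ and $\mathscr{H}$, respectively. For semi-regular $A$ there is a unique partial isometry $U_A\in\mathcal{L}(\mathscr{H},\mathscr{K})$ such that $A=U_A(A^*A)^{1/2}$ and $U_A^*U_A=P_{\overline{\mathcal{R}(A^* )}}$ (known fact); this is the partial isometry associated with $A$. The reduced solution of $AX=C$ is the operator $D\in\mathcal{L}(\mathscr{H})$ with $AD=C$ and $\mathcal{R}(D)\subseteq\overline{\mathcal{R}(A^* )}$; it is unique if it exists, and it is known to exist whenever $\overline{\mathcal{R}(A^* )}$ is orthogonally complemented and $\mathcal{R}(C)\subseteq\mathcal{R}(A)$. *)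

(* Defs.v *)
From HB Require Import structures.
From mathcomp Require Import all_boot all_order all_algebra.
From mathcomp Require Import all_classical all_reals all_analysis.
From mathcomp Require Import complex.

Set Implicit Arguments.
Unset Strict Implicit.
Unset Printing Implicit Defensive.

Import Order.TTheory GRing.Theory Num.Theory.
Import numFieldNormedType.Exports.

Local Open Scope classical_set_scope.
Local Open Scope ring_scope.
Local Open Scope complex_scope.

Declare Scope cstar_scope.
Delimit Scope cstar_scope with cstar.
Local Open Scope cstar_scope.

(* C*-algebras need not have a unit, so they cannot be built on top of
   the unital ring structures.  The norm takes its values in
   R[i], as for any normedModType R[i]. *)
HB.mixin Record isCStarAlgebra (R : realType) A
    of CompleteNormedModule R[i] A := {
  cmul : A -> A -> A ;
  cstar : A -> A ;
  cmulA : forall a b c : A, cmul a (cmul b c) = cmul (cmul a b) c ;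
  cmulDl : forall a b c : A, cmul (a + b) c = cmul a c + cmul b c ;
  cmulDr : forall a b c : A, cmul a (b + c) = cmul a b + cmul a c ;
  cmulZl : forall (k : R[i]) (a b : A), cmul (k *: a) b = k *: cmul a b ;
  cmulZr : forall (k : R[i]) (a b : A), cmul a (k *: b) = k *: cmul a b ;
  cstarK : forall a : A, cstar (cstar a) = a ;
  cstarD : forall a b : A, cstar (a + b) = cstar a + cstar b ;
  cstarZ : forall (k : R[i]) (a : A), cstar (k *: a) = k^* *: cstar a ;
  cstarM : forall a b : A, cstar (cmul a b) = cmul (cstar b) (cstar a) ;
  cnormM : forall a b : A, `|cmul a b| <= `|a| * `|b| ;
  cnorm_star : forall a : A, `|cmul (cstar a) a| = `|a| ^+ 2
}.

#[short(type="cstarAlgType")]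
HB.structure Definition CStarAlgebra (R : realType) :=
  {A of CompleteNormedModule R[i] A & isCStarAlgebra R A}.

Notation "a *c b" := (cmul a b)
  (at level 40, left associativity) : cstar_scope.
Notation "a ^c*" := (cstar a) (at level 2, format "a ^c*") : cstar_scope.

Definition cpositive (R : realType) (A : cstarAlgType R) (a : A) : Prop :=
  exists b : A, a = b^c* *c b.

(* Right modules, with an inner product that is linear in its second variable.
   The carrier is a complete normed space whose norm is the one induced by the
   inner product (hdot_norm), so that all topological notions on a Hilbert
   module are relative to that norm. *)
HB.mixin Record isHilbertModule (R : realType) (A : cstarAlgType R) H
    of CompleteNormedModule R[i] H := {
  hact : H -> A -> H ;
  hdot : H -> H -> A ;
  hactDl : forall (x y : H) (a : A), hact (x + y) a = hact x a + hact y a ;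
  hactDr : forall (x : H) (a b : A), hact x (a + b) = hact x a + hact x b ;
  hactM : forall (x : H) (a b : A), hact x (a *c b) = hact (hact x a) b ;
  hactZl : forall (k : R[i]) (x : H) (a : A), hact (k *: x) a = k *: hact x a ;
  hactZr : forall (k : R[i]) (x : H) (a : A), hact x (k *: a) = k *: hact x a ;
  hdotDr : forall x y z : H, hdot x (y + z) = hdot x y + hdot x z ;
  hdotZr : forall (k : R[i]) (x y : H), hdot x (k *: y) = k *: hdot x y ;
  hdot_act : forall (x y : H) (a : A), hdot x (hact y a) = hdot x y *c a ;
  hdotC : forall x y : H, hdot y x = (hdot x y)^c* ;
  hdot_ge0 : forall x : H, cpositive (hdot x x) ;
  hdot_eq0 : forall x : H, hdot x x = 0 -> x = 0 ;
  hdot_norm : forall x : H, `|x| ^+ 2 = `|hdot x x|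
}.

#[short(type="hilbertModType")]
HB.structure Definition HilbertModule (R : realType) (A : cstarAlgType R) :=
  {H of CompleteNormedModule R[i] H & isHilbertModule R A H}.

Notation "'<( x , y )>" := (hdot x y)
  (at level 0, format "''<(' x ,  y ')>'") : cstar_scope.

Section HilbertModuleTheory.
Context {R : realType} {A : cstarAlgType R}.
Implicit Types H K : hilbertModType A.

Lemma hdotDl H (x y z : H) : '<(x + y, z)> = '<(x, z)> + '<(y, z)>.
Proof. by rewrite [LHS]hdotC hdotDr cstarD -!hdotC. Qed.

Lemma hdotBr H (x y z : H) : '<(x, y - z)> = '<(x, y)> - '<(x, z)>.
Proof. by rewrite hdotDr -scaleN1r hdotZr scaleN1r. Qed.

Lemma hdot0r H (x : H) : '<(x, 0)> = 0.
Proof. by rewrite -(subrr (0 : H)) hdotBr subrr. Qed.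

Lemma hdotBl H (x y z : H) : '<(x - y, z)> = '<(x, z)> - '<(y, z)>.
Proof. by apply/eqP; rewrite eq_sym subr_eq -hdotDl subrK. Qed.

Lemma hdot0l H (x : H) : '<(0, x)> = 0.
Proof. by rewrite -(subrr (0 : H)) hdotBl subrr. Qed.

Definition orthogonal_compl H (M : set H) : set H :=
  [set x | forall y, M y -> '<(x, y)> = 0].

Definition orthogonally_complemented H (M : set H) : Prop :=
  [set x + y | x in M & y in orthogonal_compl M] = [set: H] /\
  M `&` orthogonal_compl M = [set 0].

Definition is_adjoint H K (T : H -> K) (S : K -> H) : Prop :=
  forall x y, '<(T x, y)> = '<(x, S y)>.

Definition adjointable H K : {pred H -> K} :=
  fun T => `[< exists S, is_adjoint T S >].

Lemma adjointableP H K (T : H -> K) (S : K -> H) :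
  is_adjoint T S -> T \in @adjointable H K.
Proof. by move=> TS; apply/asboolP; exists S. Qed.

Fact adjointable_zmod_closed H K : zmod_closed (@adjointable H K).
Proof.
split=> [|T1 T2 /asboolP[S1 TS1] /asboolP[S2 TS2]].
  by apply: (@adjointableP _ _ _ (fun=> 0)) => x y; rewrite hdot0l hdot0r.
apply: (@adjointableP _ _ _ (fun y => S1 y - S2 y)) => x y.
by rewrite hdotBl TS1 TS2 hdotBr.
Qed.

HB.instance Definition _ H K :=
  GRing.isZmodClosed.Build (H -> K) (@adjointable H K)
    (adjointable_zmod_closed H K).

Record adjop H K := Adjop {
  adjop_fun :> H -> K ;
  adjop_adjointable : adjop_fun \in @adjointable H K
}.

HB.instance Definition _ H K := [isSub for @adjop_fun H K].
HB.instance Definition _ H K := [Choice of adjop H K by <:].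
HB.instance Definition _ H K := [SubChoice_isSubZmodule of adjop H K by <:].

End HilbertModuleTheory.

Notation "''L' ( H , K )" := (adjop H K)
  (at level 8, format "''L' ( H ,  K )") : type_scope.
Notation "''L' ( H )" := (adjop H H)
  (at level 8, format "''L' ( H )") : type_scope.

Section AdjointableOperators.
Context {R : realType} {A : cstarAlgType R}.
Implicit Types H K G : hilbertModType A.

Lemma adj_exists H K (T : 'L(H, K)) : exists S, is_adjoint T S.
Proof. exact/asboolP/(adjop_adjointable T). Qed.

Definition adj_fun H K (T : 'L(H, K)) : K -> H := projT1 (cid (adj_exists T)).

Lemma adj_funP H K (T : 'L(H, K)) : is_adjoint T (adj_fun T).
Proof. exact: projT2 (cid (adj_exists T)). Qed.

Fact adj_subproof H K (T : 'L(H, K)) : adj_fun T \in @adjointable _ _ K H.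
Proof.
by apply: (@adjointableP _ _ _ _ _ T) => x y; rewrite hdotC -adj_funP -hdotC.
Qed.

Definition adj H K (T : 'L(H, K)) : 'L(K, H) := Adjop (adj_subproof T).

Fact opid_subproof H : (id : H -> H) \in @adjointable _ _ H H.
Proof. exact: (@adjointableP _ _ _ _ _ id). Qed.

Definition opid H : 'L(H) := Adjop (opid_subproof H).

Fact opcomp_subproof H K G (S : 'L(K, G)) (T : 'L(H, K)) :
  S \o T \in @adjointable _ _ H G.
Proof.
by apply: (@adjointableP _ _ _ _ _ (adj T \o adj S)) => x y /=;
  rewrite !adj_funP.
Qed.

Definition opcomp H K G (S : 'L(K, G)) (T : 'L(H, K)) : 'L(H, G) :=
  Adjop (opcomp_subproof S T).

End AdjointableOperators.

Arguments opid {R A H}.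

Notation "T ^†" := (adj T) (at level 2, format "T ^†") : cstar_scope.
Notation "S ∘ T" := (opcomp S T)
  (at level 40, left associativity) : cstar_scope.

Section OperatorNotions.
Context {R : realType} {A : cstarAlgType R}.
Implicit Types H K : hilbertModType A.

Definition self_adjoint H (T : 'L(H)) : Prop := T^† = T.

Definition op_positive H (T : 'L(H)) : Prop :=
  exists S : 'L(H), T = S^† ∘ S.

Definition is_op_sqrt H (T S : 'L(H)) : Prop := op_positive S /\ S ∘ S = T.

Definition is_projection H (P : 'L(H)) : Prop := self_adjoint P /\ P ∘ P = P.

Definition is_projection_onto H (M : set H) (P : 'L(H)) : Prop :=
  is_projection P /\ range P = M.

Definition is_partial_isometry H K (U : 'L(H, K)) : Prop :=
  is_projection (U^† ∘ U).

Definition semi_regular H K (T : 'L(H, K)) : Prop :=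
  orthogonally_complemented (closure (range T)) /\
  orthogonally_complemented (closure (range T^†)).

Definition is_associated_partial_isometry H K (T U : 'L(H, K)) : Prop :=
  [/\ is_partial_isometry U,
      exists S : 'L(H), is_op_sqrt (T^† ∘ T) S /\ T = U ∘ S &
      is_projection_onto (closure (range T^†)) (U^† ∘ U)].

Definition is_reduced_solution H K (T C : 'L(H, K)) (D : 'L(H)) : Prop :=
  T ∘ D = C /\ range D `<=` closure (range T^†).

End OperatorNotions.

(* Main.v *)
Require Import Defs.
From mathcomp Require Import all_boot all_order all_algebra.
From mathcomp Require Import all_classical all_reals all_analysis.
From mathcomp Require Import complex.

(** Let [P] be the projection onto the closure [M] of the range of [A^†]; for an
    associated partial isometry [U], the operator [U^† ∘ U] is such a [P].  Since
    the orthogonal complement of [M] is the kernel of [A], one has [A ∘ P = A],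
    and [A ∘ S = 0] forces [P ∘ S = 0] ([comp_proj], [kernel_proj]).  These two
    facts reduce the equation to algebra with [P] and [Q = opid - P].

    A self-adjoint solution [X] satisfies [P ∘ X = D], hence [X ∘ P = D^†], and
    [X = P ∘ X + Q ∘ X ∘ P + Q ∘ X ∘ Q] is the announced form with [Y = X].
    Conversely [D + Q ∘ D^†] solves the equation because [A ∘ Q = 0]; it equals
    [D + D^† - P ∘ D^†], so it is self-adjoint as soon as [D ∘ P] is.  The
    hypothesis that [C ∘ A^†] is self-adjoint says that
    [A ∘ (D - D^†) ∘ A^† = 0]; cancelling [A] by [kernel_proj], on the left and,
    after taking adjoints, on the right, turns this into
    [P ∘ (D - D^†) ∘ P = 0], which is what is needed.

    The analytic part is the existence of the reduced solution
    ([reduced_solution_exists]).  As a map, [D x = P y] for any [y] with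
    [A y = C x].  For adjointability, the value of the adjoint at [A^† k] has
    to be [C^† k], so it must be shown that this prescription extends to [M] by
    continuity, i.e. that [|C^† k| <= c |A^† k|] for some constant [c]
    ([range_sub_adj_bound]).  That is an application of the uniform boundedness
    principle to the functionals [x |-> <C^† k, x> / |A^† k|]: if [A y = C x],
    they are [<A^† k, y> / |A^† k|] at [x], hence bounded in terms of [y] alone.

    Both the continuity of these functionals and the passages to the limit rest
    on a bound of the inner product by a multiple of [|x| |y|].  Such a
    bound, with constant [4], follows from polarization and the triangle
    inequality ([hdot_bound]). *)

Set Implicit Arguments.
Unset Strict Implicit.
Unset Printing Implicit Defensive.

Import Order.TTheory GRing.Theory Num.Theory.
Import numFieldNormedType.Exports.

Local Open Scope classical_set_scope.
Local Open Scope ring_scope.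
Local Open Scope cstar_scope.

(** * Limits and uniform boundedness over the complex numbers *)

Section ComplexNorm.
Local Open Scope complex_scope.
Local Open Scope ring_scope.
Variable R : realType.
Implicit Types (V : completeNormedModType R[i]).

Lemma complex_archi (q : R[i]) : q \is Num.real -> exists n : nat, q < n%:R.
Proof.
move=> /complex_realP[k ->]; exists (Num.bound `|k|).
rewrite -(rmorph_nat (real_complex R)) ltcR.
by apply: le_lt_trans (ler_norm k) (archi_boundP (normr_ge0 k)).
Qed.

(** Positive elements of [R[i]] are real, hence comparable, although the order of
    [R[i]] is partial. *)
Lemma common_radius (a b : R[i]) : 0 < a -> 0 < b ->
  exists c : R[i], [/\ 0 < c, c <= a & c <= b].
Proof.
move=> a0 b0.
have [ab|/ltW ba] := real_leP (gtr0_real a0) (gtr0_real b0).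
- by exists a.
- by exists b.
Qed.

Lemma div_nat_small (q e : R[i]) : 0 <= q -> 0 < e -> exists n : nat, q / n.+1%:R < e.
Proof.
move=> q0 e0; have qe : q / e \is Num.real by apply: ger0_real; rewrite divr_ge0// ltW.
have [n qn] := complex_archi qe; exists n.
rewrite ltr_pdivrMr ?ltr0n// -ltr_pdivrMl// mulrC (lt_trans qn)//.
by rewrite ltr_nat.
Qed.

Lemma eq0_norm_small (W : normedModType R[i]) (a : W) (q : R[i]) : 0 <= q ->
  (forall n, `|a| <= q / n.+1%:R) -> a = 0.
Proof.
move=> q0 aq; apply/eqP; apply: contraT; rewrite -normr_gt0 => a_gt0.
by have [n /(le_lt_trans (aq n))] := div_nat_small q0 a_gt0; rewrite ltxx.
Qed.

Lemma closure_approx (W : normedModType R[i]) (S : set W) (z : W) (n : nat) :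
  closure S z -> exists2 s, S s & `|z - s| <= n.+1%:R^-1.
Proof.
have n0 : 0 < n.+1%:R^-1 :> R[i] by rewrite invr_gt0 ltr0Sn.
move=> /(_ _ (nbhsx_ballx z _ n0))[s [Ss]].
by rewrite -ball_normE /ball_ /= => /ltW zs; exists s.
Qed.

(** The bound on the limit is the given rate itself, so that a limit of centres of
    nested closed balls lies in each of the balls. *)
Lemma cauchy_limit V (u : nat -> V) (rho : nat -> R[i]) (q : R[i]) : 0 <= q ->
  (forall n, rho n <= q / n.+1%:R) ->
  (forall n p, (n <= p)%N -> `|u p - u n| <= rho n) ->
  exists l, forall n, `|l - u n| <= rho n.
Proof.
move=> q0 rhoq urho.
have ucvg : cvg (u @ \oo).
  apply/cauchy_cvgP/cauchy_exP => e /(div_nat_small q0)[n qn]; exists (u n), n => //.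
  move=> p /= np; rewrite -ball_normE /ball_ /= distrC.
  by rewrite (le_lt_trans (urho _ _ np)) ?(le_lt_trans (rhoq n)).
exists (lim (u @ \oo)) => n; apply/ler_addgt0Pr => e e0.
have /cvgrPdist_lt/(_ e e0)[m _ um] := ucvg.
pose p := maxn m n.
rewrite -(subrKA (u p)) (le_trans (ler_normD _ _))// addrC lerD//.
  by rewrite urho// leq_maxr.
by rewrite ltW// um//= leq_maxl.
Qed.

Section UniformBoundedness.
Variables (V : completeNormedModType R[i]) (W : normedModType R[i]).
Variables (I : Type) (T : I -> V -> W).
Hypothesis T_linear : forall i, linear (T i).
Hypothesis T_bounded :
  forall i, exists2 c : R[i], 0 <= c & forall x, `|T i x| <= c * `|x|.

Let TD i x y : T i (x + y) = T i x + T i y.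
Proof. by have := T_linear i 1 x y; rewrite !scale1r. Qed.

Let T0 i : T i 0 = 0.
Proof. by apply/(addIr (T i 0)); rewrite -TD !add0r. Qed.

Let TZ i a x : T i (a *: x) = a *: T i x.
Proof. by have := T_linear i a x 0; rewrite T0 !addr0. Qed.

Let TB i x y : T i (x - y) = T i x - T i y.
Proof. by rewrite TD -scaleN1r TZ scaleN1r. Qed.

(** A family bounded by [N] on a ball of radius [r] is bounded by [2 N / r] times
    the norm, by translating the ball to the origin.  Hence a family without a
    uniform bound takes large values in every ball. *)
Lemma large_in_ball (N r : R[i]) (x : V) : 0 <= N -> 0 < r ->
  ~ (exists2 M : R[i], 0 <= M & forall i v, `|T i v| <= M * `|v|) ->
  exists i y, `|y - x| <= r /\ N < `|T i y|.
Proof.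
move=> N0 r0 unbounded; apply: contrapT => none; apply: unbounded.
have small i y : `|y - x| <= r -> `|T i y| <= N.
  move=> yr; rewrite real_leNgt ?normr_real ?ger0_real//.
  by apply/negP => Ny; apply: none; exists i, y.
exists ((N + N) / r) => [|i v]; first by rewrite divr_ge0 ?addr_ge0// ltW.
have [->|v0] := eqVneq v 0; first by rewrite T0 !normr0 mulr0.
have nv : 0 < `|v| by rewrite normr_gt0.
pose w := (r / `|v|) *: v.
have wr : `|w| = r.
  by rewrite normrZ ger0_norm ?divfK ?gt_eqF// divr_ge0// ltW.
have : `|T i w| <= N + N.
  rewrite -[w](addrK x) TB (le_trans (ler_normB _ _))// lerD// small//.
    by rewrite addrK wr.
  by rewrite subrr normr0 ltW.
rewrite TZ normrZ ger0_norm; last by rewrite divr_ge0// ltW.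
rewrite mulrAC ler_pdivrMr//.
by rewrite -ler_pdivlMl// mulrA [r^-1 * _]mulrC.
Qed.

(** The principle of Banach and Steinhaus.  If there were no uniform bound, one
    could construct nested closed balls with radii tending to [0] such that some
    member of the family exceeds [n] on the whole [n]-th ball; at the common
    point of the balls the family would not be pointwise bounded. *)
Theorem uniform_boundedness :
  (forall x, exists c, forall i, `|T i x| <= c) ->
  exists2 M : R[i], 0 <= M & forall i v, `|T i v| <= M * `|v|.
Proof.
move=> pointwise; apply: contrapT => unbounded.
(* A ball is encoded as a pair of a centre and a radius. *)
have step (n : nat) (b : V * R[i]) : exists b' : V * R[i], 0 < b.2 ->
    [/\ 0 < b'.2, b'.2 <= n.+1%:R^-1, `|b'.1 - b.1| + b'.2 <= b.2 &
        exists i, forall y, `|y - b'.1| <= b'.2 -> n%:R < `|T i y|].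
  have [r0|] := boolP (0 < b.2); last by exists b.
  have [i [x [xb nx]]] :=
    large_in_ball b.1 (ler0n _ n) (divr_gt0 r0 (ltr0Sn _ 1)) unbounded.
  have [c c0 Tc] := T_bounded i.
  (* [T i] varies by less than the gap within this radius; adding [1] to [c]
     covers the case [c = 0]. *)
  have gap0 : 0 < (`|T i x| - n%:R) / (c + 1).
    by rewrite divr_gt0 ?subr_gt0// ltr_wpDl.
  have n1_gt0 : 0 < n.+1%:R^-1 :> R[i] by rewrite invr_gt0 ltr0Sn.
  have [r1 [r1_gt0 r1n r1gap]] := common_radius n1_gt0 gap0.
  have [r2 [r2_gt0 r2r1 r2b]] := common_radius r1_gt0 (divr_gt0 r0 (ltr0Sn _ 1)).
  exists (x, r2) => _; split => //=.
  - exact: le_trans r2r1 r1n.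
  - by rewrite [leRHS](splitr b.2) lerD.
  - exists i => y yx.
    have Tyx : `|T i y - T i x| < `|T i x| - n%:R.
      rewrite -TB (le_lt_trans (Tc _))//.
      rewrite (le_lt_trans (ler_wpM2l c0 (le_trans yx (le_trans r2r1 r1gap))))//.
      rewrite mulrA ltr_pdivrMr ?ltr_wpDl// mulrC ltr_pM2l ?subr_gt0//.
      by rewrite ltrDl.
    have : `|T i x| <= `|T i y - T i x| + `|T i y|.
      by rewrite distrC -{1}(subrK (T i y) (T i x)) ler_normD.
    move=> Tx_le; rewrite -(ltrD2l (`|T i x| - n%:R)) subrK.
    by rewrite (le_lt_trans Tx_le)// ltrD2r.
pose next n b := projT1 (cid (step n b)).
have nextP n b := projT2 (cid (step n b)).
pose s := fix s n := if n is n'.+1 then next n (s n') else next 0 (0, 1).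
have s_gt0 n : 0 < (s n).2.
  by elim: n => [|n IHn]; [have [] := nextP 0%N (0, 1) ltr01
                          |have [] := nextP n.+1 (s n) IHn].
have s_small n : (s n).2 <= 1 / n.+1%:R.
  rewrite div1r; case: n => [|n]; first by have [] := nextP 0%N (0, 1) ltr01.
  by have [] := nextP n.+1 (s n) (s_gt0 n).
have s_big n : exists i, forall y, `|y - (s n).1| <= (s n).2 -> n%:R < `|T i y|.
  case: n => [|n]; first by have [] := nextP 0%N (0, 1) ltr01.
  by have [] := nextP n.+1 (s n) (s_gt0 n).
have s_nested n p : (n <= p)%N -> `|(s p).1 - (s n).1| + (s p).2 <= (s n).2.
  elim: p => [|p IHp]; first by rewrite leqn0 => /eqP->; rewrite subrr normr0 add0r.
  rewrite leq_eqVlt => /predU1P[->|]; first by rewrite subrr normr0 add0r.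
  rewrite ltnS => /IHp; apply: le_trans.
  have [_ _ Sp _] := nextP p.+1 (s p) (s_gt0 p).
  apply: le_trans (lerD (lexx _) Sp); rewrite addrA lerD2r.
  by rewrite addrC -{1}(subrKA (s p).1) ler_normD.
have s_cauchy n p : (n <= p)%N -> `|(s p).1 - (s n).1| <= (s n).2.
  by move=> /s_nested; apply: le_trans; rewrite lerDl ltW.
have [l l_in] := cauchy_limit ler01 s_small s_cauchy.
have [c Tlc] := pointwise l.
have [i0 _] := s_big 0%N.
have c_real : c \is Num.real by apply: ger0_real; exact: le_trans (Tlc i0).
have [n cn] := complex_archi c_real.
have [i /(_ _ (l_in n))] := s_big n.
by move=> /lt_le_trans/(_ (Tlc i))/lt_trans/(_ cn); rewrite ltxx.
Qed.

End UniformBoundedness.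

End ComplexNorm.

(** * Boundedness of the inner product *)

Section InnerProduct.
Local Open Scope complex_scope.
Local Open Scope ring_scope.
Context {R : realType} {A : cstarAlgType R} {H : hilbertModType A}.
Implicit Types (x y z : H) (k : R[i]).

Lemma hdotZl k x y : '<(k *: x, y)> = k^* *: '<(x, y)>.
Proof. by rewrite hdotC hdotZr cstarZ -hdotC. Qed.

Lemma cstar0 : (0 : A)^c* = 0.
Proof. by apply: (addIr (0 : A)^c*); rewrite -cstarD !add0r. Qed.

Lemma hdot_sym0 x y : '<(x, y)> = 0 -> '<(y, x)> = 0.
Proof. by move=> xy0; rewrite hdotC xy0 cstar0. Qed.

Lemma hdot_inj x y : (forall z, '<(z, x)> = '<(z, y)>) -> x = y.
Proof.
by move=> xy; apply/eqP; rewrite -subr_eq0; apply/eqP/hdot_eq0; rewrite hdotBr xy subrr.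
Qed.

Lemma polarization (j : R[i]) x y : j^* = - j -> j ^+ 2 = -1 ->
  '<(x, y)> *+ 4 =
    ('<(x + y, x + y)> - '<(x - y, x - y)>) -
    j *: ('<(x + j *: y, x + j *: y)> - '<(x - j *: y, x - j *: y)>).
Proof.
move=> jJ j2.
have diff (u v : H) : '<(u + v, u + v)> - '<(u - v, u - v)> =
    ('<(u, v)> + '<(v, u)>) *+ 2 :> A.
  have double (a b : A) : (a + b) - (a - b) = b *+ 2.
    by rewrite opprB [a + b]addrC addrACA subrr addr0 mulr2n.
  rewrite (_ : '<(u - v, u - v)> =
    ('<(u, u)> + '<(v, v)>) - ('<(v, u)> + '<(u, v)>)); last first.
    by rewrite hdotBr !hdotBl opprB addrACA -opprD.
  rewrite hdotDr !hdotDl ['<(u, v)> + '<(v, v)>]addrC addrACA double.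
  by rewrite [_ + '<(u, v)>]addrC.
rewrite !diff hdotZl hdotZr jJ scaleNr -scalerBr.
rewrite -scalerMnr scalerA -expr2 j2 scaleN1r -mulrnBl.
by rewrite opprK addrACA subrr addr0 -mulr2n -mulrnA.
Qed.

(** A Cauchy-Schwarz inequality with a worse constant: for unit vectors, the four
    vectors in the polarization identity have norm at most [2], which gives
    [16 / 4]; the general case follows by scaling. *)
Lemma hdot_bound x y : `|'<(x, y)>| <= 4 * (`|x| * `|y|).
Proof.
have unit_bound (u v : H) : `|u| = 1 -> `|v| = 1 -> `|'<(u, v)>| <= 4.
  move=> u1 v1.
  have i1 : `|'i *: v| = 1 by rewrite normrZ v1 normCi mulr1.
  have sq_bound (z : H) : `|z| <= 2 -> `|'<(z, z)>| <= 4.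
    by move=> z2; rewrite -hdot_norm [leRHS](_ : _ = 2 ^+ 2) ?lerXn2r ?nnegrE// -natrX.
  have diff_bound (w : H) : `|w| = 1 -> `|'<(u + w, u + w)> - '<(u - w, u - w)>| <= 4 + 4.
    move=> w1; rewrite (le_trans (ler_normB _ _))// lerD//; apply: sq_bound.
      by rewrite (le_trans (ler_normD _ _))// u1 w1.
    by rewrite (le_trans (ler_normB _ _))// u1 w1.
  have := polarization u v (conjCi _) (sqrCi _).
  move=> /(congr1 Num.norm); rewrite normrMn => polar.
  rewrite -(@ler_pMn2r _ 4)// polar (le_trans (ler_normB _ _))//.
  rewrite normrZ normCi mul1r.
  rewrite (le_trans (lerD (diff_bound _ v1) (diff_bound _ i1)))//.
  by rewrite -!natrD -mulrnA.
have [->|x0] := eqVneq x 0; first by rewrite hdot0l !normr0 mul0r mulr0.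
have [->|y0] := eqVneq y 0; first by rewrite hdot0r !normr0 !mulr0.
have nx : 0 < `|x| by rewrite normr_gt0.
have ny : 0 < `|y| by rewrite normr_gt0.
have nx1 : `| `|x|^-1 *: x | = 1 by rewrite normrZ normfV normr_id mulVf ?gt_eqF.
have ny1 : `| `|y|^-1 *: y | = 1 by rewrite normrZ normfV normr_id mulVf ?gt_eqF.
have := unit_bound _ _ nx1 ny1.
rewrite hdotZl hdotZr !normrZ norm_conjC !normfV !normr_id.
by rewrite mulrA -invfM ler_pdivrMl ?mulr_gt0// mulrC.
Qed.

End InnerProduct.

(** * The algebra of adjointable operators *)

Section Adjoint.
Context {R : realType} {A : cstarAlgType R}.
Implicit Types H K G : hilbertModType A.

Lemma hdot_adj H K (T : 'L(H, K)) x y : '<(T x, y)> = '<(x, T^† y)>.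
Proof. exact: adj_funP. Qed.

Lemma hdot_adjl H K (T : 'L(H, K)) x y : '<(T^† x, y)> = '<(x, T y)>.
Proof. by rewrite hdotC -hdot_adj -hdotC. Qed.

Lemma adjop_ext H K (S T : 'L(H, K)) : (forall x, S x = T x) -> S = T.
Proof. by move=> ST; apply/val_inj/funext. Qed.

Lemma adjP H K (T : 'L(H, K)) (S : 'L(K, H)) :
  (forall x y, '<(T x, y)> = '<(x, S y)>) -> T^† = S.
Proof.
by move=> TS; apply: adjop_ext => y; apply: hdot_inj => x; rewrite -TS hdot_adj.
Qed.

Lemma adjK H K (T : 'L(H, K)) : T^†^† = T.
Proof. by apply: adjP => x y; rewrite hdot_adjl. Qed.

Lemma adjD H K (S T : 'L(H, K)) : (S + T)^† = S^† + T^†.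
Proof. by apply: adjP => x y; rewrite hdotDr hdotDl !hdot_adj. Qed.

Lemma adjB H K (S T : 'L(H, K)) : (S - T)^† = S^† - T^†.
Proof. by apply: adjP => x y; rewrite hdotBr hdotBl !hdot_adj. Qed.

Lemma adj_comp H K G (S : 'L(K, G)) (T : 'L(H, K)) : (S ∘ T)^† = T^† ∘ S^†.
Proof. by apply: adjP => x y; rewrite /= !hdot_adj. Qed.

Lemma adj_id H : (opid : 'L(H))^† = opid.
Proof. exact: adjP. Qed.

Lemma adjopB H K (T : 'L(H, K)) x y : T (x - y) = T x - T y.
Proof.
apply: hdot_inj => z; rewrite hdotBr.
by rewrite -!hdot_adjl hdotBr.
Qed.

Lemma opcompDl H K G (S S' : 'L(K, G)) (T : 'L(H, K)) :
  (S + S') ∘ T = S ∘ T + S' ∘ T.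
Proof. exact: adjop_ext. Qed.

Lemma opcompBl H K G (S S' : 'L(K, G)) (T : 'L(H, K)) :
  (S - S') ∘ T = S ∘ T - S' ∘ T.
Proof. exact: adjop_ext. Qed.

Lemma opcompBr H K G (S : 'L(K, G)) (T T' : 'L(H, K)) :
  S ∘ (T - T') = S ∘ T - S ∘ T'.
Proof. by apply: adjop_ext => x; rewrite /= adjopB. Qed.

Lemma opcompDr H K G (S : 'L(K, G)) (T T' : 'L(H, K)) :
  S ∘ (T + T') = S ∘ T + S ∘ T'.
Proof.
by apply/eqP; rewrite -subr_eq -opcompBr addrK.
Qed.

Lemma opcompA H K G F (Q : 'L(G, F)) (S : 'L(K, G)) (T : 'L(H, K)) :
  Q ∘ (S ∘ T) = Q ∘ S ∘ T.
Proof. exact: adjop_ext. Qed.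

Lemma opcomp0l H K G (T : 'L(H, K)) : (0 : 'L(K, G)) ∘ T = 0.
Proof. exact: adjop_ext. Qed.

Lemma opcomp1l H K (T : 'L(H, K)) : opid ∘ T = T.
Proof. exact: adjop_ext. Qed.

Lemma opcomp1r H K (T : 'L(H, K)) : T ∘ opid = T.
Proof. exact: adjop_ext. Qed.

End Adjoint.

(** * Range inclusion and reduced solutions *)

Section RangeInclusion.
Local Open Scope complex_scope.
Local Open Scope ring_scope.
Context {R : realType} {A : cstarAlgType R}.
Implicit Types H K G : hilbertModType A.

Lemma orthogonal_closure H (S : set H) (x z : H) :
  (forall s, S s -> '<(x, s)> = 0) -> closure S z -> '<(x, z)> = 0.
Proof.
move=> xS Sz; apply: (@eq0_norm_small _ _ _ (4 * `|x|)) => [|n].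
  by rewrite mulr_ge0.
have [s Ss zs] := closure_approx n Sz.
rewrite -[X in '<(_, X)>](subrK s) hdotDr (xS s)// addr0.
by rewrite (le_trans (hdot_bound _ _))// mulrA ler_wpM2l// mulr_ge0.
Qed.

Lemma projection_exists H (M : set H) :
  orthogonally_complemented M -> exists P : 'L(H), is_projection_onto M P.
Proof.
move=> [sumM _].
have decomp z : exists x, M x /\ orthogonal_compl M (z - x).
  have : [set: H] z by [].
  by rewrite -sumM => -[x Mx [y yM <-]]; exists x; rewrite addrAC subrr add0r.
pose p z := projT1 (cid (decomp z)).
have pM z : M (p z) by have [] := projT2 (cid (decomp z)).
have pC z : orthogonal_compl M (z - p z) by have [] := projT2 (cid (decomp z)).
have dot_p x y : '<(p x, y)> = '<(p x, p y)>.
  rewrite -{1}(subrK (p y) y) hdotDr hdot_sym0 ?add0r//; exact: pC.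
have p_adj x y : '<(p x, y)> = '<(x, p y)>.
  by rewrite dot_p [RHS]hdotC [X in X^c*]dot_p -hdotC.
have p_fix x : M x -> p x = x.
  move=> Mx; apply/eqP; rewrite eq_sym -subr_eq0; apply/eqP/hdot_eq0.
  by rewrite hdotBr !pC// subrr.
pose P : 'L(H) := Adjop (adjointableP p_adj).
exists P; split; first split.
- exact: adjP.
- by apply: adjop_ext => x /=; exact: p_fix.
- by apply/seteqP; split=> [_ [x _ <-]|x Mx]; [exact: pM|exists x => //; exact: p_fix].
Qed.

(** Half of the factorization theorem of Douglas.  The constant comes from uniform
    boundedness applied to [x |-> <C^† k, x> / |T^† k|], and is then evaluated at
    [x = C^† k]. *)
Lemma range_sub_adj_bound H K G (T : 'L(H, K)) (C : 'L(G, K)) :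
  range C `<=` range T ->
  exists2 M : R[i], 0 <= M & forall k, `|C^† k| <= M * `|T^† k|.
Proof.
(* For [T^† k = 0] the inverse is [0], so that [F k] vanishes. *)
move=> CT; pose F k x := `|T^† k|^-1 *: '<(C^† k, x)>.
have F_linear k : linear (F k).
  by move=> a x y; rewrite /F hdotDr hdotZr scalerDr !scalerA mulrC.
have F_bounded k : exists2 c : R[i], 0 <= c & forall x, `|F k x| <= c * `|x|.
  exists (`|T^† k|^-1 * (4 * `|C^† k|)) => [|x].
    by rewrite !mulr_ge0// invr_ge0.
  by rewrite normrZ normfV normr_id -!mulrA ler_wpM2l ?invr_ge0// hdot_bound.
have F_pointwise x : exists c : R[i], forall k, `|F k x| <= c.
  have [y _ TyCx] : range T (C x) by apply: CT; exists x.
  exists (4 * `|y|) => k; rewrite normrZ normfV normr_id hdot_adjl -TyCx -hdot_adjl.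
  have [->|Tk0] := eqVneq (T^† k) 0; first by rewrite normr0 invr0 mul0r mulr_ge0.
  rewrite ler_pdivrMl ?normr_gt0// (le_trans (hdot_bound _ _))//.
  by rewrite mulrCA.
have [M M0 FM] := uniform_boundedness F_linear F_bounded F_pointwise.
exists M => // k; have [->|Ck0] := eqVneq (C^† k) 0; first by rewrite normr0 mulr_ge0.
have Tk0 : 0 < `|T^† k|.
  rewrite normr_gt0; apply: contra_neq Ck0 => Tk0; apply: hdot_eq0.
  have [y _ TyCx] : range T (C (C^† k)) by apply: CT; exists (C^† k).
  by rewrite hdot_adjl -TyCx -hdot_adjl Tk0 hdot0l.
have := FM k (C^† k); rewrite normrZ normfV normr_id -hdot_norm expr2 mulrA.
by rewrite ler_pM2r ?normr_gt0// ler_pdivrMl// mulrC.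
Qed.

(** When [D] is the reduced solution of [T ∘ D = C], the vector [e] is the value of
    its adjoint at [z].  For [z = T^† k] it is [C^† k]; in general it is the limit
    of [C^† (k n)], where [T^† (k n)] tends to [z]. *)
Lemma adjoint_value H K G (T : 'L(H, K)) (C : 'L(G, K)) (z : H) :
  range C `<=` range T -> closure (range T^†) z ->
  exists e, forall x y, T y = C x -> '<(y, z)> = '<(x, e)>.
Proof.
move=> /range_sub_adj_bound[M M0 CM] clz.
have approx n : exists k, `|z - T^† k| <= n.+1%:R^-1.
  by have [_ [k _ <-]] := closure_approx n clz; exists k.
pose k n := projT1 (cid (approx n)).
have kP n : `|z - T^† (k n)| <= n.+1%:R^-1 := projT2 (cid (approx n)).
(* Both [T^† (k n)] and [T^† (k p)] are within [1 / n.+1] of [z], hence the [2]. *)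
have k_cauchy n p : (n <= p)%N ->
    `|C^† (k p) - C^† (k n)| <= (M * 2) / n.+1%:R.
  move=> np; rewrite -adjopB (le_trans (CM _))// -mulrA ler_wpM2l// adjopB.
  rewrite distrC -(subrKA z) (le_trans (ler_normD _ _))// mulr2n mulrDl !mul1r.
  rewrite lerD//; first by rewrite distrC.
  by rewrite (le_trans (kP p))// lef_pV2 ?posrE ?ltr0Sn// ler_nat.
have [e eP] := cauchy_limit (mulr_ge0 M0 (ler0n _ 2)) (fun=> lexx _) k_cauchy.
exists e => x y TyCx; apply/eqP; rewrite -subr_eq0; apply/eqP.
apply: (@eq0_norm_small _ _ _ (4 * `|y| + 4 * `|x| * (M * 2))) => [|n].
  by rewrite addr_ge0// !mulr_ge0.
have same : '<(y, T^† (k n))> = '<(x, C^† (k n))> by rewrite -!hdot_adj TyCx.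
rewrite -(subrKA '<(y, T^† (k n))>) -hdotBr same -hdotBr.
rewrite (le_trans (ler_normD _ _))// mulrDl lerD// (le_trans (hdot_bound _ _))//.
  by rewrite mulrA ler_wpM2l// mulr_ge0.
by rewrite mulrA -[leRHS]mulrA ler_wpM2l// 1?mulr_ge0// distrC.
Qed.

(** * Solutions in terms of the projection onto the closed range of the adjoint *)

Section Projection.
Variables (H K : hilbertModType A) (T : 'L(H, K)) (P : 'L(H)).
Hypothesis P_onto : is_projection_onto (closure (range T^†)) P.

Let P_sa : P^† = P. Proof. by case: P_onto => -[]. Qed.

Let PP : P ∘ P = P. Proof. by case: P_onto => -[]. Qed.

Lemma proj_closure x : closure (range T^†) (P x).
Proof. by case: P_onto => _ <-; exists x. Qed.

Lemma proj_id x : closure (range T^†) x -> P x = x.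
Proof. by case: P_onto => _ <- [y _ <-]; rewrite -[LHS]/((P ∘ P) y) PP. Qed.

(** The kernel of [T] is orthogonal to the range of [T^†], hence to its closure,
    which is the range of [P]. *)
Lemma kernel_proj G (S : 'L(G, H)) : T ∘ S = 0 -> P ∘ S = 0.
Proof.
move=> TS0; apply: adjop_ext => x; apply: hdot_inj => y; rewrite hdot0r /=.
rewrite -hdot_adjl P_sa; apply: hdot_sym0.
apply: (orthogonal_closure _ (@proj_closure y)) => _ [k _ <-].
by rewrite -hdot_adj -[T _]/((T ∘ S) x) TS0 hdot0l.
Qed.

(** By duality: [P] fixes the range of [T^†], so [P ∘ T^† = T^†]. *)
Lemma comp_proj : T ∘ P = T.
Proof.
apply: adjop_ext => x; apply: hdot_inj => k; rewrite /=.
rewrite -[LHS]hdot_adjl -[RHS]hdot_adjl -[LHS]hdot_adjl P_sa proj_id//.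
by apply: subset_closure; exists k.
Qed.

Lemma reduced_solution_proj (C : 'L(H, K)) (D : 'L(H)) :
  is_reduced_solution T C D -> P ∘ D = D.
Proof. by move=> [_ Dcl]; apply: adjop_ext => x; apply/proj_id/Dcl; exists x. Qed.

(** Projecting an arbitrary preimage of [C x] under [T] gives a map whose adjoint is
    computed by [adjoint_value]. *)
Lemma reduced_solution_exists (C : 'L(H, K)) :
  range C `<=` range T -> exists D : 'L(H), is_reduced_solution T C D.
Proof.
move=> CT.
have sol x : exists y, T y = C x.
  by have [y _ Ty] : range T (C x) by [apply: CT; exists x]; exists y.
pose d x := P (projT1 (cid (sol x))).
have adj_d m : exists e, forall x, '<(d x, m)> = '<(x, e)>.
  have [e eP] := adjoint_value CT (@proj_closure m).
  exists e => x; rewrite /d -{1}P_sa hdot_adjl.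
  exact: eP (projT2 (cid (sol x))).
have d_adj x m : '<(d x, m)> = '<(x, projT1 (cid (adj_d m)))>.
  exact: projT2 (cid (adj_d m)) x.
exists (Adjop (adjointableP d_adj)); split.
  apply: adjop_ext => x /=; rewrite /d -[LHS]/((T ∘ P) _) comp_proj.
  exact: projT2 (cid (sol x)).
by move=> _ [x _ <-]; exact: proj_closure.
Qed.

Let Q : 'L(H) := opid - P.

Let Q_sa : Q^† = Q. Proof. by rewrite adjB adj_id P_sa. Qed.

Let TQ : T ∘ Q = 0. Proof. by rewrite opcompBr opcomp1r comp_proj subrr. Qed.

(** The operator is [D + D^† - P ∘ D^†], and [P ∘ D^† = D ∘ P] is obtained by
    cancelling [T] on both sides of [T ∘ (D - D^†) ∘ T^† = 0]. *)
Lemma particular_self_adjoint (C : 'L(H, K)) (D : 'L(H)) :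
  is_reduced_solution T C D -> self_adjoint (C ∘ T^†) ->
  self_adjoint (D + Q ∘ D^†).
Proof.
move=> redD CTsa; have PD := reduced_solution_proj redD; case: redD => TD _.
have DP : D^† ∘ P = D^† by rewrite -[in RHS]PD adj_comp P_sa.
have TZT : T ∘ ((D - D^†) ∘ T^†) = 0.
  move: CTsa; rewrite /self_adjoint -TD !adj_comp adjK => CTsa.
  by rewrite opcompBl opcompBr CTsa opcompA subrr.
have PZT : P ∘ ((D - D^†) ∘ T^†) = 0 := kernel_proj TZT.
have TZP : T ∘ ((D^† - D) ∘ P) = 0.
  have := congr1 (@adj _ _ _ _) PZT.
  rewrite !adj_comp adjB !adjK P_sa -opcompA => ->.
  by apply: adjP => x y; rewrite /= hdot0l hdot0r.
have := kernel_proj TZP; rewrite opcompBl DP opcompBr opcompA PD => /eqP.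
rewrite subr_eq0 => /eqP PDs.
rewrite /self_adjoint adjD adj_comp adjK Q_sa /Q.
by rewrite opcompBl opcompBr opcomp1l opcomp1r -PDs PDs addrCA.
Qed.

Lemma particular_solution (C : 'L(H, K)) (D : 'L(H)) :
  is_reduced_solution T C D -> T ∘ (D + Q ∘ D^†) = C.
Proof.
move=> [TD _]; rewrite opcompDr TD opcompA TQ.
by rewrite opcomp0l addr0.
Qed.

(** A self-adjoint solution is recovered by taking itself as the parameter: since
    [P ∘ X = D] and [X ∘ P = D^†], its blocks other than [Q ∘ X ∘ Q] are determined
    by [D]. *)
Lemma general_solution (C : 'L(H, K)) (D X : 'L(H)) :
  is_reduced_solution T C D -> self_adjoint (C ∘ T^†) ->
  (self_adjoint X /\ T ∘ X = C) <->
  (exists Y : 'L(H), self_adjoint Y /\ X = D + Q ∘ D^† + Q ∘ Y ∘ Q).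
Proof.
move=> redD CTsa; split=> [[Xsa TX]|[Y [Ysa ->]]].
  exists X; split=> //.
  have [TD _] := redD.
  have : P ∘ (X - D) = 0 by apply: kernel_proj; rewrite opcompBr TX TD subrr.
  rewrite opcompBr (reduced_solution_proj redD) => /eqP.
  rewrite subr_eq0 => /eqP PX.
  rewrite -PX adj_comp Xsa P_sa opcompA -addrA -opcompDr.
  have PQ : P + Q = opid by rewrite addrC subrK.
  by rewrite PQ opcomp1r -opcompDl PQ opcomp1l.
split.
  rewrite /self_adjoint adjD (particular_self_adjoint redD CTsa) !adj_comp Q_sa Ysa.
  by rewrite opcompA.
rewrite opcompDr (particular_solution redD) !opcompA TQ.
by rewrite !opcomp0l addr0.
Qed.

End Projection.
End RangeInclusion.

Theorem theorem2p8 (R : realType) (𝔄 : cstarAlgType R)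
    (H K : hilbertModType 𝔄) (A : 'L(H, K)) (hA : semi_regular A)
    (C : 'L(H, K)) :
  ((exists X : 'L(H), self_adjoint X /\ A ∘ X = C) <->
     (range C `<=` range A /\ self_adjoint (C ∘ A^†))) /\
  (range C `<=` range A -> self_adjoint (C ∘ A^†) ->
     (exists D : 'L(H), is_reduced_solution A C D) /\
     forall (D : 'L(H)) (U : 'L(H, K)),
       is_reduced_solution A C D -> is_associated_partial_isometry A U ->
       forall X : 'L(H),
         (self_adjoint X /\ A ∘ X = C) <->
         (exists Y : 'L(H), self_adjoint Y /\
            X = D + (opid - U^† ∘ U) ∘ D^† + (opid - U^† ∘ U) ∘ Y ∘ (opid - U^† ∘ U))).
Proof.
have [P P_onto] := projection_exists (proj2 hA).
split; last first.
  move=> CA CAsa; split; first exact: (reduced_solution_exists P_onto).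
  by move=> D U redD [_ _ U_onto] X; exact: general_solution.
split=> [[X [Xsa <-]]|[CA CAsa]].
  split; first by move=> _ [x _ <-]; exists (X x).
  by rewrite /self_adjoint !adj_comp adjK Xsa opcompA.
have [D redD] := reduced_solution_exists P_onto CA.
exists (D + (opid - P) ∘ D^†); split.
  exact: (particular_self_adjoint P_onto redD CAsa).
exact: (particular_solution P_onto redD).
Qed.
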